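(* Let $K$ be a finite-dimensional simplex and let $J$ be a good subset of $K$. Then there exist a (possibly empty) face $F$ of $K$ together with a finite set of faces $F_i$ of $K$, each of dimension at least one, such that the collection $\{F,F_1,F_2,\dots\}$ is disjoint, together with points $v_i$ in the relative interior of $F_i$, such that $J$ is the convex hull of $F\cup\{v_i\}_i$.
   Context: For a compact convex set $X$, $\mathrm{Aff}(X)$ is the space of continuous affine real-valued functions on $X$ and $\mathrm{Aff}(X)^{++}$ the strictly positive ones; $f\ll g$ means $f<g$ everywhere (with difference bounded below by a positive constant). A nonempty subset $J$ of a Choquet simplex $K$ is good if: (i) $J$ is a compact Choquet simplex; (ii) there is a closed flat (affine subspace) $\mathcal L$ with $J=\mathcal L\cap K$; (iii) whenever $a\in\mathrm{Aff}(J)^{++}$ and $b\in\mathrm{Aff}(K)^{++}$ satisfy $a\ll b|_J$, there exists $a'\in\mathrm{Aff}(K)^{++}$ with $a'|_J=a$ and $a'\ll b$. A finite collection of faces of $K$ is disjoint if the affine span of each one does not meet the affine span of the union of the others (for two faces of a simplex this just means they have empty intersection). The finite set of faces $F_i$ may be empty. *)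

(* Defs.v *)
From HB Require Import structures.
From mathcomp Require Import all_boot all_order all_algebra.
From mathcomp Require Import all_classical all_reals all_analysis.

Set Implicit Arguments.
Unset Strict Implicit.
Unset Printing Implicit Defensive.

Import Order.TTheory GRing.Theory Num.Theory.
Import numFieldNormedType.Exports.

Local Open Scope classical_set_scope.
Local Open Scope ring_scope.

Section ConvexGeometry.
Context {R : realType} {V : normedModType R}.
Implicit Types (A F J K L : set V) (x y : V).

(* The empty set is convex and is a flat, so it is its own convex hull and its
   own affine span. *)
Definition convex_hull A : set V := smallest (@convex_set R V) A.

Definition is_flat L : Prop :=
  forall x y (t : R), L x -> L y -> L (t *: x + (1 - t) *: y).

Definition affine_span A : set V := smallest is_flat A.

Definition affinely_independent n (p : 'I_n -> V) : Prop :=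
  forall c : 'I_n -> R,
    \sum_(i < n) c i = 0 -> \sum_(i < n) c i *: p i = 0 -> forall i, c i = 0.

(* dim A >= d, where dim A is one less than the maximal number of affinely
   independent points of A (so dim set0 = -1) *)
Definition affine_dim_ge d A : Prop :=
  exists p : 'I_d.+1 -> V, (forall i, A (p i)) /\ affinely_independent p.

Definition finite_dim_simplex K : Prop :=
  exists (n : nat) (p : 'I_n.+1 -> V),
    affinely_independent p /\ K = convex_hull (range p).

(* set0 is a face of every K *)
Definition is_face K F : Prop :=
  [/\ F `<=` K, @convex_set R V F &
    forall x y (t : R), K x -> K y -> 0 < t < 1 ->
      F (t *: x + (1 - t) *: y) -> F x /\ F y].

Definition relative_interior A : set V :=
  [set x | A x /\ \forall y \near x, affine_span A y -> A y].

(* Disjointness is that of an indexed family: a nonempty set cannot be repeated. *)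
Definition disjoint_faces (I : Type) (F : I -> set V) : Prop :=
  forall i, affine_span (F i) `&`
            affine_span (\bigcup_(j in [set j | j <> i]) F j) = set0.

(* Elements of Aff(A) are represented by functions on V, of which only the
   restriction to A matters. *)
Definition Aff A (f : V -> R) : Prop :=
  {within A, continuous f} /\
  forall x y (t : R), A x -> A y -> 0 <= t <= 1 ->
    f (t *: x + (1 - t) *: y) = t * f x + (1 - t) * f y.

Definition Aff_pos A (f : V -> R) : Prop := Aff A f /\ forall x, A x -> 0 < f x.

Definition much_less A (f g : V -> R) : Prop :=
  exists2 e : R, 0 < e & forall x, A x -> f x + e <= g x.

End ConvexGeometry.

Section LatticeCone.
Context {E : zmodType}.
Implicit Types (P : set E) (u v w : E).

Definition cone_span P : set E :=
  [set u | exists p q, [/\ P p, P q & u = p - q]].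

Definition cone_le P u v : Prop := P (v - u).

Definition cone_sup P u v w : Prop :=
  [/\ cone_span P w, cone_le P u w, cone_le P v w &
    forall z, cone_span P z -> cone_le P u z -> cone_le P v z -> cone_le P w z].

Definition cone_inf P u v w : Prop :=
  [/\ cone_span P w, cone_le P w u, cone_le P w v &
    forall z, cone_span P z -> cone_le P z u -> cone_le P z v -> cone_le P z w].

Definition lattice_cone P : Prop :=
  forall u v, cone_span P u -> cone_span P v ->
    (exists w, cone_sup P u v w) /\ (exists w, cone_inf P u v w).

End LatticeCone.

Section Choquet.
Context {R : realType} {V : normedModType R}.
Implicit Types (J K L : set V).

(* The cone with base J * {1}. *)
Definition cone_over J : set (V * R) :=
  [set u | exists (t : R) (x : V), [/\ 0 <= t, J x & u = (t *: x, t)]].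

(* Choquet's definition: a compact convex set is a simplex when it is a base of
   a lattice cone. *)
Definition choquet_simplex J : Prop :=
  [/\ compact J, @convex_set R V J & lattice_cone (cone_over J)].

Definition good K J : Prop :=
  [/\ J !=set0,
      choquet_simplex J,
      exists L, [/\ is_flat L, closed L & J = L `&` K] &
      forall a b : V -> R, Aff_pos J a -> Aff_pos K b -> much_less J a b ->
        exists a' : V -> R,
          [/\ Aff_pos K a', (forall x, J x -> a' x = a x) & much_less K a' b]].

End Choquet.

(* Main.v *)
Require Import Defs.
From HB Require Import structures.
From mathcomp Require Import all_boot all_order all_algebra.
From mathcomp Require Import all_classical all_reals all_analysis.
From mathcomp Require Import ring lra.
Import Order.TTheory GRing.Theory Num.Theory.
Import numFieldNormedType.Exports.
Local Open Scope classical_set_scope.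
Local Open Scope ring_scope.

(* Let l_j be the barycentric coordinates of K.  The lifting property (iii),
   with b approximating a nonnegative combination of the l_j, says in the limit
   that any combination f of the l_j with 0 <= f <= \sum_j b_j l_j on J equals
   \sum_j s_j l_j on J for some 0 <= s_j <= b_j.  In particular a coordinate
   dominated on J by a multiple of l_i is proportional to l_i on J.  It follows
   that every linear relation between the l_j on J splits into relations inside
   the proportionality classes.  Hence every affine function vanishing on the
   flat that cuts out J vanishes at the normalised projection v_C of a point of
   J to the coordinates in one class C, so v_C lies in J, and J is the convex
   hull of the v_C, whose supports are disjoint.  The classes of size one give
   F and the others give the F_i. *)

Set Implicit Arguments.
Unset Strict Implicit.
Unset Printing Implicit Defensive.

(** * Convexity, flats and affine maps *)

Section Affine.
Context {R : realType} {V : normedModType R}.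
Implicit Types (A L : set V) (f : V -> R).

Definition affine_map f : Prop :=
  forall x y (t : R), f (t *: x + (1 - t) *: y) = t * f x + (1 - t) * f y.

Lemma convex_setP A : @convex_set R V A <->
  forall x y (t : R), A x -> A y -> 0 <= t <= 1 -> A (t *: x + (1 - t) *: y).
Proof.
split=> [cA x y t Ax Ay /andP[t0 t1]|cA x y l].
  have := cA x y (Itv01 t0 t1); rewrite !inE => /(_ Ax Ay); exact.
rewrite !inE => Ax Ay; apply: cA => //.
by apply/andP; split.
Qed.

Lemma convex_hull_convex A : @convex_set R V (convex_hull A).
Proof.
apply/convex_setP => x y t Ax Ay t01 C C_; case: (C_) => /convex_setP cC _.
exact: cC (Ax C C_) (Ay C C_) t01.
Qed.

Lemma affine_span_flat A : is_flat (affine_span A).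
Proof. by move=> x y t Ax Ay C C_; case: (C_) => fC _; exact: fC (Ax C C_) (Ay C C_). Qed.

Lemma affine_map_sum (I : finType) (d : I -> R) (f : I -> V -> R) :
  (forall i, affine_map (f i)) -> affine_map (fun x => \sum_i d i * f i x).
Proof.
move=> af x y t; rewrite !mulr_sumr -big_split /=; apply: eq_bigr => i _.
by rewrite af; ring.
Qed.

Lemma continuous_lincomb (I : finType) (d : I -> R) (f : I -> V -> R) :
  (forall i, continuous (f i)) -> continuous (fun x => \sum_i d i * f i x).
Proof.
move=> cf; apply: (continuous_big (op := +%R)) => [|i _ x].
  exact: add_continuous.
by apply: cvgM; [exact: cvg_cst | exact: cf].
Qed.

(** Induction on the number of indices: one of positive weight is split off and the other weights
    are rescaled by their sum [S]. Membership is asked only at positive weights, since vertices of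
    weight zero may lie outside [J] at the end of the main proof. *)
Lemma convex_comb (I : finType) (P : pred I) A (t : I -> R) (x : I -> V) :
  @convex_set R V A -> (forall i, P i -> 0 <= t i) -> \sum_(i | P i) t i = 1 ->
  (forall i, P i -> 0 < t i -> A (x i)) -> A (\sum_(i | P i) t i *: x i).
Proof.
move=> cA; elim: {P}_.+1 {-2}P (ltnSn #|P|) t => // N IH P PN t t0 t1 Ax.
have [i /andP[Pi ti]] : exists i, P i && (0 < t i).
  apply/existsP; apply: contraT => /existsPn h.
  suff : \sum_(i | P i) t i = 0 by rewrite t1 => /eqP; rewrite oner_eq0.
  apply: big1 => i Pi; apply/eqP; move: (h i); rewrite Pi /= -leNgt => ti.
  by rewrite eq_le ti t0.
rewrite (bigD1 i) //=; move: t1; rewrite (bigD1 i) //=.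
set S := \sum_(j | _) t j => t1.
have S0 : 0 <= S by apply: sumr_ge0 => j /andP[/t0].
have [S00|Sn0] := eqVneq S 0.
  rewrite big1 ?addr0 => [|j Pj].
    have -> : t i = 1 by lra.
    rewrite scale1r; exact: Ax.
  suff -> : t j = 0 by rewrite scale0r.
  have : forall j, P j && (j != i) -> 0 <= t j by move=> k /andP[/t0].
  by move/psumr_eq0P => /(_ S00 j Pj).
have Sp : 0 < S by rewrite lt_neqAle eq_sym Sn0.
have -> : \sum_(j | P j && (j != i)) t j *: x j =
    S *: \sum_(j | P j && (j != i)) (t j / S) *: x j.
  rewrite scaler_sumr; apply: eq_bigr => j _.
  by rewrite scalerA mulrCA divff// mulr1.
have St : 1 - t i = S by lra.
rewrite -{1}St.
move/convex_setP: (cA); apply; first exact: Ax.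
- apply: (IH [pred j | P j && (j != i)]) => [|j /andP[/t0 tj _]||j /andP[Pj _] tj].
  + rewrite -ltnS; apply: leq_trans PN; rewrite ltnS; apply/proper_card/properP.
    split; first by apply/fintype.subsetP => j; rewrite !inE => /andP[].
    by exists i; rewrite ?inE ?unfold_in ?eqxx ?andbF.
  + by rewrite divr_ge0// ltW.
  + by rewrite -mulr_suml divff.
  + by apply: Ax => //; move: tj; rewrite pmulr_lgt0// invr_gt0.
- by apply/andP; split; [exact: ltW | lra].
Qed.

End Affine.

(** * Flats and barycentric coordinates through matrices *)

Section RowVectors.
Context {R : realType} {m : nat}.
Implicit Types (L : set 'rV[R]_m).

Lemma mulmx_entry_affine n (M : 'M[R]_(m, n)) (c : R) j :
  affine_map (fun x : 'rV[R]_m => (x *m M) 0 j + c).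
Proof. by move=> x y t; rewrite mulmxDl -!scalemxAl !mxE; ring. Qed.

Lemma mulmx_entry_continuous n (M : 'M[R]_(m, n)) (c : R) j :
  continuous (fun x : 'rV[R]_m => (x *m M) 0 j + c).
Proof.
have cM : continuous (fun y : 'rV[R]_m => \sum_i M i j * y 0 i).
  by apply: continuous_lincomb => i; exact: coord_continuous.
have -> : (fun y : 'rV[R]_m => (y *m M) 0 j + c) =
    (fun y => \sum_i M i j * y 0 i + c).
  apply/funext => y; rewrite mxE; congr (_ + _).
  by apply: eq_bigr => i _; rewrite mulrC.
by move=> x; apply: continuousD; [exact: cM | exact: cst_continuous].
Qed.

(** Scaling about [x0] is the flat condition with second point [x0], and a sum of directions is
    twice their midpoint. So the directions form a linear subspace. *)
Lemma flat_linear L x0 : is_flat L -> L x0 ->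
  [/\ forall (t : R) y, L (x0 + y) -> L (x0 + t *: y) &
      forall y z, L (x0 + y) -> L (x0 + z) -> L (x0 + (y + z))].
Proof.
move=> fL Lx0.
have LZ (t : R) y : L (x0 + y) -> L (x0 + t *: y).
  move=> Ly; have := fL _ _ t Ly Lx0.
  by rewrite scalerDr addrAC -scalerDl addrCA subrr addr0 scale1r.
split=> // y z Ly Lz.
have := LZ 2 _ _; move=> /(_ (2^-1 *: y + 2^-1 *: z)).
rewrite -scalerDr scalerA divff ?pnatr_eq0// scale1r; apply.
have := fL _ _ (2^-1) Ly Lz.
have -> : 1 - 2^-1 = 2^-1 :> R by lra.
suff -> : 2^-1 *: (x0 + y) + 2^-1 *: (x0 + z) =
  x0 + 2^-1 *: (y + z) by [].
by apply/rowP => i; rewrite !mxE; field.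
Qed.

(** The directions of [L] are the row space of a matrix [A] of maximal rank, and a row vector lies
    in it exactly when [cokermx A] kills it. Some entry of [(x - x0) *m cokermx A] is therefore
    nonzero and yields [f]. *)
Lemma flat_separation L x0 x : is_flat L -> L x0 -> ~ L x ->
  exists f : 'rV[R]_m -> R, [/\ affine_map f, forall y, L y -> f y = 0 & f x != 0].
Proof.
move=> fL Lx0 Lx; have [LZ LD] := flat_linear fL Lx0.
pose rows_in k (A : 'M[R]_(k, m)) := forall i, L (x0 + row i A).
pose P r := `[< exists k (A : 'M[R]_(k, m)), rows_in k A /\ \rank A = r >].
have exP : exists r, P r.
  exists 0%N; apply/asboolP; exists 0%N, 0; split; last by rewrite mxrank0.
  by case.
have bP r : P r -> (r <= m)%N.
  by move=> /asboolP[k [A [_ <-]]]; exact: rank_leq_col.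
have [r /asboolP[k [A [AL rA]]] maxr] := ex_maxnP exP bP.
have subL y : (y <= A)%MS -> L (x0 + y).
  move=> /submxP[u ->]; rewrite mulmx_sum_row.
  by apply: (big_ind (fun y => L (x0 + y))) => [||i _];
    [rewrite addr0 | exact: LD | exact: LZ].
have Lsub y : L (x0 + y) -> (y <= A)%MS.
  (* A direction outside the row space could be appended to [A], raising the maximal rank. *)
  move=> Ly; apply: contraT => yA.
  have /rank_ltmx : (A < col_mx A y)%MS.
    by rewrite ltmxE -!addsmxE addsmxSl addsmx_sub submx_refl.
  rewrite rA ltnNge maxr//; apply/asboolP; exists (k + 1)%N, (col_mx A y); split=> //.
  move=> i; case: (split_ordP i) => j ->; first by rewrite rowKu.
  by rewrite rowKd ord1 row_id.
have xA : ~~ ((x - x0) <= A)%MS.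
  by apply/negP => /subL; rewrite addrC subrK.
move: xA; rewrite submxE => /eqP/rowP xA.
have [j xj] : exists j, ((x - x0) *m cokermx A) 0 j != 0.
  apply: contrapT => h; apply: xA => j; rewrite [RHS]mxE; apply/eqP.
  by apply: contrapT => /negP hj; apply: h; exists j.
exists (fun y => ((y - x0) *m cokermx A) 0 j); split => //.
- rewrite (_ : (fun _ => _) = (fun y => (y *m cokermx A) 0 j + - (x0 *m cokermx A) 0 j)).
    exact: mulmx_entry_affine.
  by apply/funext => y; rewrite mulmxBl !mxE.
- move=> y Ly; have : ((y - x0) <= A)%MS by apply: Lsub; rewrite addrC subrK.
  by rewrite submxE => /eqP ->; rewrite mxE.
Qed.

(** Affine independence of the [p i] is linear independence of the rows [(p i, 1)], so the matrix of
    these rows has a right inverse [Q], whose columns give the coordinates. *)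
Lemma barycentric_coordinates n (p : 'I_n -> 'rV[R]_m) : affinely_independent p ->
  exists l : 'I_n -> 'rV[R]_m -> R,
  [/\ forall i j, l i (p j) = (i == j)%:R, forall i, affine_map (l i) &
      forall i, continuous (l i)].
Proof.
move=> aff_p; pose P := \matrix_(i < n) row_mx (p i) (1%:M : 'M[R]_1).
have /row_freeP[Q PQ] : row_free P.
  rewrite -kermx_eq0; apply/rowV0P => c /sub_kermxP.
  rewrite mulmx_sum_row; under eq_bigr do rewrite rowK scale_row_mx.
  have -> : \sum_(i < n) row_mx (c 0 i *: p i) (c 0 i *: (1%:M : 'M[R]_1)) =
     row_mx (\sum_(i < n) c 0 i *: p i) ((\sum_(i < n) c 0 i) *: 1%:M).
    rewrite scaler_suml.
    by elim/big_rec3 : _ => [|i u v w _ ->]; rewrite ?row_mx0 ?add_row_mx.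
  rewrite -[RHS]row_mx0 => /eq_row_mx[c1 /matrixP/(_ 0 0)].
  rewrite !mxE eqxx mulr1 => c0; apply/rowP => i; rewrite mxE.
  exact: (aff_p (c 0) c0 c1).
have Pp j : row_mx (p j) 1%:M *m Q = row j 1%:M.
  by rewrite -PQ row_mul rowK.
have lE j x : (row_mx x (1%:M : 'M[R]_1) *m Q) 0 j = (x *m usubmx Q) 0 j + dsubmx Q 0 j.
  by rewrite -{1}[Q]vsubmxK mul_row_col mul1mx mxE.
exists (fun i x => (x *m usubmx Q) 0 i + dsubmx Q 0 i); split.
- by move=> i j; rewrite -lE Pp !mxE eq_sym.
- by move=> i; exact: mulmx_entry_affine.
- by move=> i; exact: mulmx_entry_continuous.
Qed.

End RowVectors.

(** * The simplex described by its barycentric coordinates *)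

Section Simplex.
Context {R : realType} {V : normedModType R}.

Lemma affine_map_comb (I : finType) (P : pred I) (t : I -> R) (x : I -> V) (f : V -> R) :
  affine_map f -> \sum_(i | P i) t i = 1 ->
  f (\sum_(i | P i) t i *: x i) = \sum_(i | P i) t i * f (x i).
Proof.
move=> af t1.
have fZ (c : R) y : f (c *: y) = c * f y + (1 - c) * f 0.
  by rewrite -af scaler0 addr0.
have fD y z : f (y + z) = f y + f z - f 0.
  have -> : y + z = 2 *: (2^-1 *: y + (1 - 2^-1) *: z).
    rewrite (_ : 1 - 2^-1 = 2^-1 :> R); last lra.
    by rewrite -scalerDr scalerA divff ?pnatr_eq0// scale1r.
  by rewrite fZ af; field.
(* For arbitrary weights, with a correction by the value at 0, the identity can be proved term by
   term. *)
suff -> : f (\sum_(i | P i) t i *: x i) =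
    \sum_(i | P i) t i * f (x i) + (1 - \sum_(i | P i) t i) * f 0.
  by rewrite t1 subrr mul0r addr0.
elim/big_rec3 : _ => [|i u v w _ IH]; first by rewrite subr0 mul1r add0r.
by rewrite fD fZ IH; ring.
Qed.

Context {n : nat} (p : 'I_n -> V) (l : 'I_n -> V -> R).
Hypothesis l_p : forall i j, l i (p j) = (i == j)%:R.
Hypothesis l_aff : forall i, affine_map (l i).
Local Notation K := (convex_hull (range p)).

Lemma hull_ind (C : set V) : @convex_set R V C -> (forall i, C (p i)) -> K `<=` C.
Proof. by move=> cC Cp; apply: smallest_sub => // _ [i _ <-]. Qed.

Lemma hull_vertex i : K (p i).
Proof. by apply: sub_gen_smallest; exists i. Qed.

Lemma sum_vertex (c : 'I_n -> R) j : \sum_i l i (p j) * c i = c j.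
Proof.
rewrite (bigD1 j)//= l_p eqxx mul1r big1 ?addr0// => i /negPf ij.
by rewrite l_p ij mul0r.
Qed.

Lemma sum_vertexZ (c : 'I_n -> V) j : \sum_i l i (p j) *: c i = c j.
Proof.
rewrite (bigD1 j)//= l_p eqxx scale1r big1 ?addr0// => i /negPf ij.
by rewrite l_p ij scale0r.
Qed.

(** The points where both sides agree form a convex set containing the vertices. Affinity is asked
    on [K] only, which is what [Aff] grants to a lifted function. *)
Lemma sum_coord (f : V -> R) x : K x ->
  (forall x y (t : R), K x -> K y -> 0 <= t <= 1 ->
    f (t *: x + (1 - t) *: y) = t * f x + (1 - t) * f y) ->
  f x = \sum_i l i x * f (p i).
Proof.
move=> Kx af; pose C := [set x | K x /\ f x = \sum_i l i x * f (p i)].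
suff : K `<=` C by move=> /(_ x Kx)[].
apply: hull_ind => [|i]; last by split; [exact: hull_vertex | rewrite sum_vertex].
apply/convex_setP => y z t [Ky fy] [Kz fz] t01; split.
  by move/convex_setP: (@convex_hull_convex _ _ (range p)); exact.
rewrite af// fy fz !mulr_sumr -big_split; apply: eq_bigr => i _ /=.
by rewrite l_aff; ring.
Qed.

Lemma hullP x : K x <->
  [/\ forall i, 0 <= l i x, \sum_i l i x = 1 & \sum_i l i x *: p i = x].
Proof.
split=> [|[l0 l1 <-]]; last first.
  apply: convex_comb => //; first exact: convex_hull_convex.
  by move=> i _ _; exact: hull_vertex.
pose C := [set x | [/\ forall i, 0 <= l i x, \sum_i l i x = 1 &
                      \sum_i l i x *: p i = x]].
suff : K `<=` C by exact.
apply: hull_ind => [|j].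
  apply/convex_setP => y z t [y0 y1 yp] [z0 z1 zp] /andP[t0 t1]; split.
  - by move=> i; rewrite l_aff addr_ge0// mulr_ge0// subr_ge0.
  - under eq_bigr do rewrite l_aff.
    by rewrite big_split -!mulr_sumr /= y1 z1; ring.
  - rewrite -{2}yp -{2}zp !scaler_sumr -big_split; apply: eq_bigr => i _ /=.
    by rewrite l_aff scalerDl !scalerA.
split=> [i||]; first by rewrite l_p ler0n.
  by under eq_bigr do rewrite -[l _ _]mulr1; rewrite sum_vertex.
by rewrite sum_vertexZ.
Qed.

Lemma coord_comb (P : pred 'I_n) (t : 'I_n -> R) i : \sum_(j | P j) t j = 1 ->
  l i (\sum_(j | P j) t j *: p j) = if P i then t i else 0.
Proof.
move=> t1; rewrite (affine_map_comb _ (l_aff i))//.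
have [Pi|nPi] := boolP (P i).
  rewrite (bigD1 i)//= l_p eqxx mulr1 big1 ?addr0// => j /andP[_ /negPf ji].
  by rewrite l_p eq_sym ji mulr0.
rewrite big1// => j Pj; rewrite l_p (_ : (i == j) = false) ?mulr0//.
by apply/eqP => ij; rewrite ij Pj in nPi.
Qed.

End Simplex.

(** * Compactness: removing the error from approximate coefficients *)

Lemma cluster_le {R : realType} {T : topologicalType} (u : nat -> T) (s : T)
    (g : T -> R) (c : R) : cluster (u @ \oo) s -> continuous g ->
  (forall k, g (u k) <= c + k.+1%:R^-1) -> g s <= c.
Proof.
move=> us cg gu; rewrite leNgt; apply/negP => cs.
pose d := (g s - c) / 2.
have d0 : 0 < d by rewrite /d; lra.
have A : (u @ \oo) [set y | g y < c + d].
  have := near_infty_natSinv_lt (PosNum d0).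
  by apply: filterS => k /= kd; apply: le_lt_trans (gu k) _; rewrite ltrD2l.
have B : nbhs s [set y | c + d < g y].
  apply: (cg s [set z | c + d < z]); apply: lt_nbhsr; rewrite /d; lra.
have [y [/= y1 y2]] := us _ _ A B.
by have := lt_trans y1 y2; rewrite ltxx.
Qed.

(** The coefficients found for the errors [1 / (k + 1)] stay in a compact box, and a cluster point
    of them satisfies the inequalities without error. *)
Lemma box_approximation {R : realType} {T : Type} n (J : set T)
    (phi : 'I_n -> T -> R) (a : T -> R) (b : 'I_n -> R) :
  (forall e, 0 < e -> exists s : 'I_n -> R, (forall j, 0 <= s j <= b j + e) /\
     forall x, J x -> `|\sum_j s j * phi j x - a x| <= e) ->
  exists s : 'I_n -> R, (forall j, 0 <= s j <= b j) /\
     forall x, J x -> \sum_j s j * phi j x = a x.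
Proof.
move=> h.
have /choice[u uP] (k : nat) := h k.+1%:R^-1 ltac:(by rewrite invr_gt0).
pose v k : 'rV[R]_n := \row_j u k j.
(* All the errors are at most 1, hence the upper ends [b j + 1]. *)
have := @rV_compact R n (fun j => `[0, b j + 1]%classic) (fun j => @segment_compact _ _ _).
move=> /(_ (v @ \oo) _)[].
  apply: (@filterE _ \oo) => k j; rewrite /= mxE in_itv /=.
  have [/(_ j)/andP[-> uk] _] := uP k; apply: le_trans uk _.
  by rewrite lerD2l invf_le1 ?ltr0n ?ler1n.
move=> s [_ sv]; exists (s 0); split=> [j|x Jx].
  apply/andP; split.
    (* [cluster_le] gives upper bounds, so lower bounds are obtained for the opposite function. *)
    rewrite -oppr_le0; apply: (cluster_le sv (g := fun y : 'rV[R]_n => - y 0 j)).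
      by move=> y; apply: continuousN; exact: coord_continuous.
    move=> k; rewrite mxE; have [/(_ j)/andP[uk _] _] := uP k.
    by rewrite add0r (le_trans (y := 0)) ?oppr_le0// invr_ge0.
  apply: (cluster_le sv (g := fun y : 'rV[R]_n => y 0 j)); first exact: coord_continuous.
  by move=> k; rewrite mxE; have [/(_ j)/andP[]] := uP k.
have cphi : continuous (fun s : 'rV[R]_n => \sum_j phi j x * s 0 j).
  by apply: continuous_lincomb => j; exact: coord_continuous.
have -> : \sum_j s 0 j * phi j x = \sum_j phi j x * s 0 j.
  by apply: eq_bigr => j _; rewrite mulrC.
have E k : \sum_j phi j x * v k 0 j = \sum_j u k j * phi j x.
  by apply: eq_bigr => j _; rewrite mxE mulrC.
apply/eqP; rewrite eq_le; apply/andP; split.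
  apply: (cluster_le sv cphi) => k; rewrite E.
  by have [_ /(_ x Jx)] := uP k; rewrite ler_distl => /andP[].
rewrite -lerN2; apply: (cluster_le sv (g := fun y : 'rV[R]_n => - \sum_j phi j x * y 0 j)).
  by move=> y; apply: continuousN; exact: cphi.
move=> k; rewrite E -[leRHS]opprK lerN2 opprD !opprK.
by have [_ /(_ x Jx)] := uP k; rewrite ler_distl => /andP[].

Qed.

(** * Proportionality classes and linear relations under the interval property *)

Definition proportional {R : realType} {T : Type} (J : set T) (f g : T -> R) : Prop :=
  exists2 t : R, 0 < t & forall x, J x -> g x = t * f x.

Lemma proportional_equivalence {R : realType} {T : Type} (I : finType) (J : set T)
    (f : I -> T -> R) (D : {set I}) :
  {in D & &, equivalence_rel (fun i j => `[< proportional J (f i) (f j) >])}.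
Proof.
move=> i j k _ _ _; split.
  by apply/asboolP; exists 1 => // x _; rewrite mul1r.
move=> /asboolP[t t0 ij]; apply/asboolP/asboolP => -[s s0 ik].
  exists (s / t) => [|x Jx]; first exact: divr_gt0.
  by rewrite ik// ij// mulrA divfK// gt_eqF.
exists (s * t) => [|x Jx]; first exact: mulr_gt0.
by rewrite ik// ij// mulrA.
Qed.

Section Interval.
Context {R : realType} {T : Type} {n : nat} (J : set T) (phi : 'I_n -> T -> R).
Hypothesis phi_ge0 : forall x j, J x -> 0 <= phi j x.
Hypothesis interval : forall d b : 'I_n -> R, (forall j, 0 <= b j) ->
  (forall x, J x -> 0 <= \sum_j d j * phi j x <= \sum_j b j * phi j x) ->
  exists s : 'I_n -> R, (forall j, 0 <= s j <= b j) /\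
    forall x, J x -> \sum_j s j * phi j x = \sum_j d j * phi j x.

Lemma sum_delta (c : R) i x : \sum_j (if j == i then c else 0) * phi j x = c * phi i x.
Proof.
rewrite (bigD1 i)//= eqxx big1 ?addr0// => j /negPf ->.
by rewrite mul0r.
Qed.

(** When [s * phi j] is represented below [c * phi i], the bounds kill every coefficient but that of
    [phi i]. The point [z] makes the remaining factor positive, as [proportional] demands. *)
Lemma dominated_proportional i j (s c : R) z : 0 < s -> 0 <= c ->
  (forall x, J x -> s * phi j x <= c * phi i x) -> J z -> 0 < phi j z ->
  proportional J (phi i) (phi j).
Proof.
move=> s0 c0 sc Jz jz.
have [|x Jx|u [ub uE]] := @interval (fun k => if k == j then s else 0)
    (fun k => if k == i then c else 0).
- by move=> k; case: ifP.
- by rewrite !sum_delta sc// mulr_ge0 ?phi_ge0 ?ltW.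
have E x : J x -> phi j x = u i / s * phi i x.
  move=> Jx; have := uE x Jx; rewrite sum_delta (bigD1 i)//= big1 => [|k /negPf ki].
    rewrite addr0 mulrAC => ->.
    by rewrite mulrAC divff ?mul1r// gt_eqF.
  have := ub k; rewrite ki => h; suff -> : u k = 0 by rewrite mul0r.
  by apply/eqP; rewrite eq_le andbC.
exists (u i / s) => //; rewrite divr_gt0// lt_neqAle; have /andP[-> _] := ub i.
rewrite andbT eq_sym; apply/eqP => ui0.
by move: jz; rewrite E// ui0 !mul0r ltxx.
Qed.

Lemma class_relation i z (d : 'I_n -> R) : J z -> 0 < phi i z ->
  (forall x, J x -> \sum_j d j * phi j x = 0) ->
  \sum_(j | `[< proportional J (phi i) (phi j) >]) d j * phi j z = 0.
Proof.
move=> Jz iz; pose C j := `[< proportional J (phi i) (phi j) >].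
change ((forall x, J x -> \sum_j d j * phi j x = 0) ->
  \sum_(j | C j) d j * phi j z = 0).
(* The negative of a relation is a relation, so one inequality suffices. *)
suff nonpos (e : 'I_n -> R) : (forall x, J x -> \sum_j e j * phi j x = 0) ->
    \sum_(j | C j) e j * phi j z <= 0.
  move=> d0; apply/eqP; rewrite eq_le nonpos//= -oppr_le0 -sumrN.
  under eq_bigr do rewrite -mulNr.
  apply: nonpos => x Jx; under eq_bigr do rewrite mulNr.
  by rewrite sumrN d0// oppr0.
move=> e0; rewrite leNgt; apply/negP => ez.
(* On the class every [phi j] is a multiple of [phi i], so the class part equals [D * phi i] on all
   of [J]; [D] is read off at [z]. *)
pose D := (\sum_(j | C j) e j * phi j z) / phi i z.
have D0 : 0 < D by exact: divr_gt0.
have eD x : J x -> \sum_(j | C j) e j * phi j x = D * phi i x.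
  move=> Jx; rewrite /D !mulr_suml; apply: eq_bigr => j /asboolP[t _ tP].
  by rewrite !tP//; field; rewrite gt_eqF.
(* The relation rewrites [D * phi i] through the functions outside the class, with coefficients
   dominated by [|e k|]. The bound 0 inside the class forces the new coefficients to vanish
   there. *)
have [|x Jx|s [sb sE]] := @interval (fun k => if k == i then D else 0)
    (fun k => if C k then 0 else `|e k|).
- by move=> k; case: ifP.
- rewrite sum_delta mulr_ge0 ?phi_ge0 ?(ltW D0)//= -eD//.
  have /eqP := e0 x Jx; rewrite (bigID C)/= addr_eq0 => /eqP ->.
  rewrite [leRHS](bigID C)/= [X in _ <= X + _]big1 => [|j ->]; last by rewrite mul0r.
  rewrite add0r.
  rewrite -sumrN; apply: ler_sum => j /negPf ->.
  by rewrite -mulNr ler_wpM2r ?phi_ge0// ler_normr lexx orbT.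
(* Such a [phi j] is dominated by a multiple of [phi i], hence [j] is in the class, where [s j] must
   be 0: a contradiction. *)
have [j sj] : exists j, 0 < s j * phi j z.
  apply: contrapT => h; suff : \sum_j s j * phi j z <= 0.
    by rewrite sE// sum_delta leNgt mulr_gt0.
  by apply: sumr_le0 => j _; rewrite leNgt; apply/negP => ?; apply: h; exists j.
have /andP[s0 sle] := sb j.
have [sj0 jz] : 0 < s j /\ 0 < phi j z.
  have := phi_ge0 j Jz; rewrite le_eqVlt => /orP[/eqP jz|jz].
    by move: sj; rewrite -jz mulr0 ltxx.
  by split=> //; move: sj; rewrite pmulr_lgt0.
have Cj : C j.
  apply/asboolP; apply: (dominated_proportional sj0 (ltW D0) _ Jz jz) => x Jx.
  rewrite -(sum_delta D) -sE// (bigD1 j)//= lerDl sumr_ge0// => k _.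
  by rewrite mulr_ge0 ?phi_ge0//; case/andP: (sb k).
by move: sle; rewrite Cj leNgt sj0.
Qed.

End Interval.

(** * Good subsets: the interval property and the projection to one class *)

Section GoodSubset.
Context {R : realType} {m n : nat}.
Context (p : 'I_n -> 'rV[R]_m) (l : 'I_n -> 'rV[R]_m -> R).
Hypothesis l_p : forall i j, l i (p j) = (i == j)%:R.
Hypothesis l_aff : forall i, affine_map (l i).
Hypothesis l_cont : forall i, continuous (l i).
Local Notation K := (convex_hull (range p)).

Lemma sum_coordD (d : 'I_n -> R) (c : R) x : K x ->
  \sum_i (d i + c) * l i x = \sum_i d i * l i x + c.
Proof.
move=> /(hullP l_p l_aff)[_ l1 _]; under eq_bigr do rewrite mulrDl.
by rewrite big_split -mulr_sumr /= l1 mulr1.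
Qed.

Lemma lincomb_Aff (d : 'I_n -> R) (A : set 'rV[R]_m) : Aff A (fun x => \sum_i d i * l i x).
Proof.
split; first by apply: continuous_subspaceT; exact: continuous_lincomb.
by move=> x y t _ _ _; exact: (affine_map_sum d l_aff).
Qed.

(** The lifting property is applied to strict perturbations of the two combinations. The values of
    the lift at the vertices serve as coefficients, and [box_approximation] removes the error. *)
Lemma good_interval (J : set 'rV[R]_m) (d b : 'I_n -> R) : good K J ->
  (forall j, 0 <= b j) ->
  (forall x, J x -> 0 <= \sum_j d j * l j x <= \sum_j b j * l j x) ->
  exists s : 'I_n -> R, (forall j, 0 <= s j <= b j) /\
    forall x, J x -> \sum_j s j * l j x = \sum_j d j * l j x.
Proof.
move=> [_ _ [L [_ _ JLK]] lift] b0 db.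
have JK : J `<=` K by rewrite JLK; exact: subIsetr.
(* Shifting the lower function by [c] and the upper one by [e] makes both positive and leaves a gap
   of at least [2 * c]. *)
apply: box_approximation => e e0; pose c := e / 3.
have c0 : 0 < c by rewrite /c; lra.
have [|||a' [[[_ a'aff] a'0] a'J [g g0 a'b]]] := lift
   (fun x => \sum_j (d j + c) * l j x) (fun x => \sum_j (b j + e) * l j x).
- split=> [|x Jx]; first exact: lincomb_Aff.
  by rewrite (sum_coordD _ _ (JK x Jx)) ltr_wpDl//; case/andP: (db x Jx).
- split=> [|x Kx]; first exact: lincomb_Aff.
  rewrite sum_coordD// ltr_wpDl// sumr_ge0// => j _.
  by rewrite mulr_ge0//; have [-> ] := (hullP l_p l_aff x).1 Kx.
- exists c => // x Jx; rewrite !(sum_coordD _ _ (JK x Jx)).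
  have /andP[_ dbx] := db x Jx.
  rewrite -addrA lerD// /c; lra.
exists (fun j => a' (p j)); split=> [j|x Jx].
  rewrite (ltW (a'0 _ (@hull_vertex _ _ _ p j)))/=.
  (* At [p j] the upper function has the value [b j + e], which bounds the coefficient. *)
  have := a'b _ (@hull_vertex _ _ _ p j).
  under [X in _ <= X]eq_bigr do rewrite mulrC.
  by rewrite (sum_vertex l_p) => /(le_trans _); apply; rewrite lerDl ltW.
under eq_bigr do rewrite mulrC.
rewrite -(sum_coord l_p l_aff (f := a') (JK x Jx))//.
rewrite a'J// (sum_coordD _ _ (JK x Jx)) addrC addKr gtr0_norm// /c; lra.
Qed.

Context (J : set 'rV[R]_m) (good_J : good K J).

Lemma good_sub : J `<=` K.
Proof. by have [_ _ [L [_ _ ->]] _] := good_J; exact: subIsetr. Qed.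

Lemma good_coord_ge0 x j : J x -> 0 <= l j x.
Proof. by move=> /good_sub/(hullP l_p l_aff)[]. Qed.

(** [v] is the normalised projection of [z] to the class. A function [f] separating [v] from [L]
    would give a relation on [J] with coefficients [f (p j)]; by [class_relation] its class part
    vanishes at [z], so [f v = 0]. The class coordinates of any [y] in [J] are a multiple of those
    of [z], so the same [v] serves for all [y]. *)
Lemma class_point i z : J z -> 0 < l i z ->
  let C j := `[< proportional J (l i) (l j) >] in
  exists v, [/\ J v, forall j, (0 < l j v) = C j &
    forall y, J y -> \sum_(j | C j) l j y *: p j = (\sum_(j | C j) l j y) *: v].
Proof.
move=> Jz iz C; have [_ _ [L [fL _ JLK]] _] := good_J.
have lz j : C j -> 0 < l j z.
  by move=> /asboolP[t t0 ->//]; rewrite mulr_gt0.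
pose w := \sum_(j | C j) l j z.
have w0 : 0 < w.
  have Ci : C i by apply/asboolP; exists 1 => // x _; rewrite mul1r.
  rewrite /w (bigD1 i)//= ltr_pwDl// sumr_ge0// => j _.
  exact: good_coord_ge0.
have t1 : \sum_(j | C j) l j z / w = 1 by rewrite -mulr_suml divff// gt_eqF.
pose v := \sum_(j | C j) (l j z / w) *: p j.
have Kv : K v.
  apply: convex_comb => //; first exact: convex_hull_convex.
    by move=> j /lz lj; rewrite divr_ge0 ?ltW.
  by move=> j _ _; exact: hull_vertex.
exists v; split.
- have Lz : L z by move: Jz; rewrite JLK => -[].
  rewrite JLK; split=> //; apply: contrapT => Lv.
  have [f [af fL0 /eqP fv]] := flat_separation fL Lz Lv; apply: fv.
  have rel x : J x -> \sum_j f (p j) * l j x = 0.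
    move=> Jx; under eq_bigr do rewrite mulrC.
    rewrite -(sum_coord l_p l_aff (f := f) (good_sub Jx)) ?fL0//.
    by move: Jx; rewrite JLK => -[].
  have := class_relation good_coord_ge0 (fun d b => @good_interval J d b good_J) Jz iz rel.
  rewrite (affine_map_comb _ af)// => E.
  under eq_bigr do rewrite mulrAC [_ * f _]mulrC.
  by rewrite -mulr_suml E mul0r.
- move=> j; rewrite (coord_comb l_p l_aff)//; case: ifP => [/lz lj|_].
    by rewrite divr_gt0.
  by rewrite ltxx.
- move=> y Jy.
  have key j : C j -> l j y = l i y / l i z * l j z.
    by move=> /asboolP[t _ tE]; rewrite !tE//; field; rewrite gt_eqF.
  have sy : \sum_(j | C j) l j y = l i y / l i z * w.
    by rewrite mulr_sumr; apply: eq_bigr.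
  rewrite scaler_sumr; apply: eq_bigr => j Cj.
  by rewrite sy scalerA key//; congr (_ *: _); field; rewrite !gt_eqF.
Qed.

End GoodSubset.

(** * Blocks of vertices and the faces they span *)

Section Decomposition.
Context {R : realType} {m n : nat}.
Context (p : 'I_n -> 'rV[R]_m) (l : 'I_n -> 'rV[R]_m -> R).
Hypothesis l_p : forall i j, l i (p j) = (i == j)%:R.
Hypothesis l_aff : forall i, affine_map (l i).
Hypothesis l_cont : forall i, continuous (l i).
Local Notation K := (convex_hull (range p)).

(** The blocks are the proportionality classes, and the weight of [y] on a block is the sum of its
    coordinates there. *)
Lemma good_blocks (J : set 'rV[R]_m) : good K J ->
  exists (P : {set {set 'I_n}}) (v : {set 'I_n} -> 'rV[R]_m),
  [/\ finset.trivIset P,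
      forall B, B \in P -> J (v B) /\ forall j, (0 < l j (v B)) = (j \in B) &
      forall y, J y -> exists w : {set 'I_n} -> R,
        [/\ forall B, 0 <= w B, \sum_(B in P) w B = 1 &
            y = \sum_(B in P) w B *: v B]].
Proof.
move=> good_J; have lJ := good_coord_ge0 l_p l_aff good_J.
pose r i j := `[< proportional J (l i) (l j) >].
(* Coordinates vanishing on all of [J] are left out, as [class_point] needs a point where the
   coordinate is positive. *)
pose D := [set j | `[< exists2 z, J z & 0 < l j z >]]%SET.
pose P := equivalence_partition r D.
have /and3P[/eqP coverP trivP _] : finset.partition P D.
  exact/equivalence_partitionP/proportional_equivalence.
have block B : B \in P -> exists i z, [/\ J z, 0 < l i z & forall j, (j \in B) = r i j].
  move=> /imsetP[i]; rewrite inE => /asboolP[z Jz iz] ->.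
  exists i, z; split=> // j; rewrite inE -/(r i j).
  apply: andb_idl => /asboolP[t t0 tP]; rewrite inE; apply/asboolP.
  by exists z => //; rewrite tP// mulr_gt0.
have /choice[v vP] : forall B, exists v, B \in P -> [/\ J v,
    forall j, (0 < l j v) = (j \in B) &
    forall y, J y -> \sum_(j in B) l j y *: p j = (\sum_(j in B) l j y) *: v].
  move=> B; have [BP|_] := boolP (B \in P); last by exists 0.
  have [i [z [Jz iz Bi]]] := block B BP.
  have [v [Jv lv vE]] := class_point l_p l_aff l_cont good_J Jz iz.
  exists v => _; split => // [j|y Jy]; first by rewrite lv Bi.
  by rewrite !(eq_bigl _ _ Bi) vE.
exists P, v; split => // [B /vP[]//|y Jy].
exists (fun B : {set 'I_n} => \sum_(j in B) l j y).
have [_ l1 lp] := (hullP l_p l_aff y).1 (good_sub good_J Jy).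
have l0 j : j \notin D -> l j y = 0.
  rewrite inE => /asboolPn h; apply/eqP; rewrite eq_le lJ// andbT leNgt.
  by apply/negP => ly; apply: h; exists y.
split.
- by move=> B; apply: sumr_ge0 => j _; exact: lJ.
- rewrite -finset.big_trivIset// coverP -[RHS]l1 [RHS](bigID [in D])/=.
  by rewrite [X in _ = _ + X]big1 ?addr0.
- rewrite -{1}lp (bigID [in D])/= [X in _ + X]big1 ?addr0 => [|j /l0 ->]; last first.
    by rewrite scale0r.
  rewrite -coverP finset.big_trivIset//; apply: eq_bigr => B /vP[_ _ ->//].
Qed.

(** Faces are indexed by vertex sets. The empty set gives the empty face, since the coordinates sum
    to 1 on [K]. *)
Definition face (S : {set 'I_n}) : set 'rV[R]_m :=
  [set x | K x /\ forall j, j \notin S -> l j x = 0].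

(** Inside a segment of [K] a coordinate, being nonnegative, vanishes only if it vanishes at both
    ends. *)
Lemma face_is_face S : is_face K (face S).
Proof.
have cK : @convex_set R 'rV[R]_m K by exact: convex_hull_convex.
split=> [x []//| |x y t Kx Ky /andP[t0 t1] [_ xy]].
  apply/convex_setP => x y t [Kx x0] [Ky y0] t01.
  split; first by move/convex_setP: cK; exact.
  by move=> j jS; rewrite l_aff x0// y0// !mulr0 addr0.
have [lx _ _] := (hullP l_p l_aff x).1 Kx.
have [ly _ _] := (hullP l_p l_aff y).1 Ky.
have xy0 j : j \notin S -> l j x = 0 /\ l j y = 0.
  move=> /xy; rewrite l_aff => /eqP.
  rewrite paddr_eq0; last by rewrite mulr_ge0 ?ly// subr_ge0 ltW.
    by rewrite !mulf_eq0 subr_eq0 (gt_eqF t0) (gt_eqF t1)//= => /andP[/eqP-> /eqP->].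
  by rewrite mulr_ge0 ?lx// ltW.
by split; split => // j /xy0[].
Qed.

(** These conditions are affine, so they pass from the face to its affine span; nonnegativity in
    general does not. *)
Lemma face_span S x : affine_span (face S) x ->
  [/\ \sum_i l i x = 1, \sum_i l i x *: p i = x & forall j, j \notin S -> l j x = 0].
Proof.
pose L := [set x | [/\ \sum_i l i x = 1, \sum_i l i x *: p i = x &
                      forall j, j \notin S -> l j x = 0]].
suff : affine_span (face S) `<=` L by exact.
apply: smallest_sub => [y z t [y1 yp y0] [z1 z1p z0]|y [/(hullP l_p l_aff)[]//]].
split.
- under eq_bigr do rewrite l_aff.
  by rewrite big_split -!mulr_sumr /= y1 z1; ring.
- rewrite -{2}yp -{2}z1p !scaler_sumr -big_split; apply: eq_bigr => i _ /=.
  by rewrite l_aff scalerDl !scalerA.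
- by move=> j jS; rewrite l_aff y0// z0// !mulr0 addr0.
Qed.

Lemma faces_disjoint (I : Type) (S : I -> {set 'I_n}) :
  (forall i j, i <> j -> [disjoint S i & S j]%B) ->
  disjoint_faces (fun i => face (S i)).
Proof.
move=> dS i; apply/seteqP; split=> // x [/face_span[x1 _ x0]].
(* The other faces lie in the face of the complementary vertices. A common point of the spans thus
   has all coordinates 0, although they sum to 1. *)
have : affine_span (\bigcup_(j in [set j | j <> i]) face (S j)) `<=`
       affine_span (face (~: S i)%SET).
  apply: smallest_sub; first exact: affine_span_flat.
  move=> y [j /= ji [Ky y0]]; apply: sub_gen_smallest; split => // k.
  rewrite inE negbK => kS; apply: y0.
  by rewrite (disjointFl (dS _ _ ji)).
move=> /[apply] /face_span[_ _ x0'].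
suff : \sum_i l i x = 0 by rewrite x1 => /eqP; rewrite oner_eq0.
apply: big1 => j _; have [jS|] := boolP (j \in S i); last exact: x0.
by apply: x0'; rewrite inE negbK.
Qed.

Lemma face_dim_ge1 (S : {set 'I_n}) : (1 < #|S|)%N -> affine_dim_ge 1 (face S).
Proof.
move=> /card_gt1P[i [j [iS jS ij]]].
have Fp k : k \in S -> face S (p k).
  move=> kS; split=> [|h hS]; first exact: hull_vertex.
  by rewrite l_p; case: eqP hS => // ->; rewrite kS.
exists (fun a : 'I_2 => if a == 0 then p i else p j); split.
  by move=> a; case: ifP => _; exact: Fp.
move=> c; rewrite !big_ord_recl !big_ord0 /= !addr0 => /eqP.
rewrite addr_eq0 => /eqP c0; rewrite c0 scaleNr addrC -scalerBr => /eqP.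
rewrite scaler_eq0 subr_eq0 => /orP[/eqP c1|/eqP pij].
  move=> a; case: (unliftP 0 a) => [b|] ->; last by rewrite c0 c1 oppr0.
  by rewrite ord1.
by have := l_p j i; rewrite -pij l_p eqxx eq_sym (negPf ij) => /eqP; rewrite oner_eq0.
Qed.

(** Near [x] the coordinates in [S] stay positive, and on the affine span the others are 0. *)
Lemma face_relative_interior (S : {set 'I_n}) x : K x -> (forall j, (0 < l j x) = (j \in S)) ->
  relative_interior (face S) x.
Proof.
move=> Kx xS; have [x0 _ _] := (hullP l_p l_aff x).1 Kx; split.
  by split=> // j; rewrite -xS => h; apply/eqP; rewrite eq_le x0 andbT leNgt.
have : \forall y \near x, forall j : 'I_n, j \in S -> 0 < l j y.
  apply: (@filter_forall _ _ (fun j y => j \in S -> 0 < l j y) (nbhs x)) => j.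
  have [jS|jS] := boolP (j \in S); last by apply: nearW => y yS; case/negP: jS.
  have : \forall y \near x, 0 < l j y.
    apply: (@l_cont j x [set z | 0 < z]); apply: (@lt_nbhsr _ 0 (l j x)).
    by rewrite xS.
  by apply: filterS => y ly _.
apply: filterS => y y0 /face_span[y1 yp yS]; split=> //.
apply/(hullP l_p l_aff); split=> // j.
by have [/y0/ltW//|/yS ->] := boolP (j \in S).
Qed.

End Decomposition.

(** * Sorting the blocks by size *)

Theorem corollaryB3 (R : realType) (m : nat) (K J : set 'rV[R]_m)
    (hK : finite_dim_simplex K) (hJ : good K J) :
  exists (F : set 'rV[R]_m) (k : nat)
         (G : 'I_k -> set 'rV[R]_m) (v : 'I_k -> 'rV[R]_m),
    [/\ is_face K F,
        (forall i, is_face K (G i) /\ affine_dim_ge 1 (G i)),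
        disjoint_faces (fun o : option 'I_k => if o is Some i then G i else F),
        (forall i, relative_interior (G i) (v i)) &
        J = convex_hull (F `|` range v)].
Proof.
case: hK hJ => n [p [/barycentric_coordinates[l [l_p l_aff l_cont]] ->]] good_J.
have JK := good_sub good_J.
have cJ : @convex_set R 'rV[R]_m J.
  have [_ _ [L [fL _ ->]] _] := good_J; apply/convex_setP => x y t [Lx Kx] [Ly Ky] t01.
  split; first exact: fL.
  by move/convex_setP: (@convex_hull_convex _ _ (range p)); exact.
have [P [v [trivP vP vJ]]] := good_blocks l_p l_aff l_cont good_J.
(* The singleton blocks supply the vertices of the face [F]; the blocks in [Q] supply the faces of
   dimension at least one. *)
pose S := [set j | [set j]%SET \in P]%SET.
pose Q := [set B in P | (1 < #|B|)%N]%SET.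
have QP i : enum_val i \in P /\ (1 < #|enum_val (A := Q) i|)%N.
  by have := enum_valP i; rewrite inE => /andP[].
(* A point of [K] whose only positive coordinate is the one at [j] is the vertex [p j]. *)
have v1 j : j \in S -> v [set j]%SET = p j.
  rewrite inE => /vP[/JK/(hullP l_p l_aff)[l0 l1 lp] lj].
  have li i : i != j -> l i (v [set j]%SET) = 0.
    by move=> ij; apply/eqP; rewrite eq_le l0 andbT leNgt lj inE.
  rewrite -lp (bigD1 j)//= big1 => [|i /li ->]; last by rewrite scale0r.
  move: l1; rewrite (bigD1 j)//= big1 => [|i /li //].
  by rewrite !addr0 => ->; rewrite scale1r.
exists (face p l S), #|Q|, (fun i => face p l (enum_val i)), (fun i => v (enum_val i)).
split.
- exact: face_is_face.
- by move=> i; split; [exact: face_is_face | apply: face_dim_ge1 => //; case: (QP i)].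
- rewrite (_ : (fun _ => _) = (fun o => face p l (if o is Some i then enum_val i else S))).
    apply: faces_disjoint => //.
    have SQ i : [disjoint S & enum_val (A := Q) i]%B.
      apply/pred0P => j /=; apply/negP => /andP[]; rewrite inE => jP ji.
      have [iP i1] := QP i.
      have /(_ _ _ jP iP) := elimT finset.trivIsetP trivP.
      have [ij|_ /(_ isT)] := eqVneq [set j]%SET (enum_val i).
        by move: i1; rewrite -ij cards1.
      by move/disjointFr => /(_ j); rewrite inE eqxx ji => /(_ isT).
    move=> [i|] [j|] // ij.
    - have /finset.trivIsetP := trivP.
      apply; [by case: (QP i)|by case: (QP j)|].
      by apply/eqP => /enum_val_inj ij'; apply: ij; rewrite ij'.
    - by rewrite disjoint_sym; exact: SQ.
  by apply/funext => -[].
- move=> i; have [iP _] := QP i; have [/JK Kv lv] := vP _ iP.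
  exact: face_relative_interior.
apply/seteqP; split=> [y /vJ[w [w0 w1 ->]]|].
  apply: convex_comb => //; first exact: convex_hull_convex.
  move=> B BP _; apply: sub_gen_smallest.
  have [B1|B1] := ltnP 1 #|B|.
    have BQ : B \in Q by rewrite inE BP.
    by right; exists (enum_rank_in BQ B) => //; rewrite enum_rankK_in.
  (* A block of at most one element that contains [j] is [[set j]], so [j] is in [S]; hence [v B]
     lies in the face of [S]. *)
  have [/JK Kv lv] := vP _ BP; left; split=> // j jS.
  have [l0 _ _] := (hullP l_p l_aff _).1 Kv.
  apply/eqP; rewrite eq_le l0 andbT leNgt lv; apply/negP => jB.
  move: jS; rewrite inE (_ : [set j]%SET = B) ?BP//.
  by apply/eqP; rewrite eqEcard finset.sub1set jB cards1.
(* A point of the face of [S] is a convex combination of vertices [p j] with [j] in [S], and these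
   lie in [J] by [v1]. *)
apply: smallest_sub => // x [[Kx xS]|[i _ <-]]; last by have [/vP[]] := QP i.
have [l0 l1 <-] := (hullP l_p l_aff x).1 Kx.
apply: convex_comb => // j _ lj.
have jS : j \in S by apply: contraT => /xS lj0; rewrite lj0 ltxx in lj.
by rewrite -v1//; move: jS; rewrite inE => /vP[].
Qed.
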